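(* Let $M > 0$, $0 < a < 1$, and let $b > 1$ be an odd integer, with $ab > 1+\frac{3}{2}\pi$. Let $W(x) = \sum_{m=0}^{\infty} a^m e^{i b^m \pi x}$ be the Weierstrass function. If a sequence of positive integers $\{n_N\}_{N \in \mathbb{N}}$ satisfies the growth condition $$\lim_{N \to \infty} \frac{(ab^3)^N}{n_N} = 0,$$ then the sequence of functions $\mathcal{W}_{N, n_N}(x)$ converges uniformly to $W(x)$ on the interval $[-M, M]$: $$\lim_{N \to \infty} \sup_{|x| \le M} \left| \mathcal{W}_{N, n_N}(x) - W(x) \right| = 0.$$
   Context: For $N\in\mathbb{N}$, a positive integer $n$, and $x\in\mathbb{R}$, the superoscillating approximation is $$\mathcal{W}_{N,n}(x) = \sum_{m=0}^{N} a^m \left[ \cos\left(\frac{x}{n}\right) + i (b^m \pi) \sin\left(\frac{x}{n}\right) \right]^n .$$ *)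

(* Defs.v *)
From Stdlib Require Import Reals ZArith Lra.
From Coquelicot Require Import Coquelicot.
Open Scope R_scope.

Definition Cexp (z : C) : C :=
  (exp (Re z) * cos (Im z), exp (Re z) * sin (Im z)).

(* Coquelicot's [Series] is real-valued only, so a complex series is summed
   componentwise. *)
Definition CSeries (u : nat -> C) : C :=
  (Series (fun m => Re (u m)), Series (fun m => Im (u m))).

Definition weierstrass_term (a b x : R) (m : nat) : C :=
  (RtoC (a ^ m) * Cexp (Ci * RtoC (b ^ m * PI * x)))%C.

Definition weierstrass (a b x : R) : C := CSeries (weierstrass_term a b x).

(* Coquelicot's [sum_n u N] has the N+1 terms u 0, ..., u N. *)
Definition superosc (a b : R) (N n : nat) (x : R) : C :=
  sum_n (fun m : nat =>
    (RtoC (a ^ m) *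
     (RtoC (cos (x / INR n)) +
      Ci * RtoC (b ^ m * PI) * RtoC (sin (x / INR n))) ^ n)%C) N.

(* The supremum is taken in the extended reals, so that it exists without any
   boundedness assumption. *)
Definition sup_dist (M : R) (f g : R -> C) : Rbar :=
  Lub_Rbar (fun y : R =>
    exists x : R, Rabs x <= M /\ y = Cmod (f x - g x)%C).

(* [is_series_CSeries] and [weierstrass_is_series] show that [CSeries] and
   [weierstrass] are genuine sums, not default values of [Series]. *)

Lemma sum_n_C_components (u : nat -> C) (n : nat) :
  sum_n u n = (sum_n (fun m => Re (u m)) n, sum_n (fun m => Im (u m)) n).
Proof.
induction n as [|n IH].
- rewrite !sum_O. now destruct (u 0%nat).
- rewrite !sum_Sn, IH. reflexivity.
Qed.

Lemma is_series_C_components (u : nat -> C) (l : C) :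
  is_series u l <->
  is_series (fun m => Re (u m)) (Re l) /\ is_series (fun m => Im (u m)) (Im l).
Proof.
unfold is_series; split.
- intros H; split; apply filterlim_locally; intros eps;
    generalize (proj1 (filterlim_locally _ _) H eps); apply filter_imp;
    intros n Hn; rewrite sum_n_C_components in Hn; apply Hn.
- intros [H1 H2]; apply filterlim_locally; intros eps.
  generalize (filter_and _ _ (proj1 (filterlim_locally _ _) H1 eps)
                             (proj1 (filterlim_locally _ _) H2 eps)).
  apply filter_imp; intros n Hn; rewrite sum_n_C_components; exact Hn.
Qed.

Lemma is_series_CSeries (u : nat -> C) (l : C) :
  is_series u l -> CSeries u = l.
Proof.
intros H; apply is_series_C_components in H; destruct H as [H1 H2].
unfold CSeries; rewrite (is_series_unique _ _ H1), (is_series_unique _ _ H2).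
now destruct l.
Qed.

Lemma ex_series_geom_bounded (a : R) (c : nat -> R) :
  0 < a < 1 -> (forall m, Rabs (c m) <= 1) ->
  ex_series (fun m => a ^ m * c m).
Proof.
intros Ha Hc.
apply (ex_series_le (V := R_CompleteNormedModule) _ (fun m => a ^ m)).
- intros m. change (Rabs (a ^ m * c m) <= a ^ m).
  assert (Hp : 0 < a ^ m) by (apply pow_lt; lra).
  rewrite Rabs_mult, (Rabs_right (a ^ m)) by lra.
  rewrite <- (Rmult_1_r (a ^ m)) at 2.
  apply Rmult_le_compat_l; [lra | apply Hc].
- apply ex_series_geom; rewrite Rabs_right; lra.
Qed.

Lemma weierstrass_is_series (a b x : R) :
  0 < a < 1 -> is_series (weierstrass_term a b x) (weierstrass a b x).
Proof.
intros Ha; apply is_series_C_components.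
assert (Hterm : forall m, weierstrass_term a b x m =
  (a ^ m * cos (b ^ m * PI * x), a ^ m * sin (b ^ m * PI * x))).
{ intros m; unfold weierstrass_term, Cexp, Cmult, RtoC, Ci, Re, Im; simpl.
  replace (0 * (b ^ m * PI * x) - 1 * 0) with 0 by ring.
  replace (0 * 0 + 1 * (b ^ m * PI * x)) with (b ^ m * PI * x) by ring.
  rewrite exp_0; f_equal; ring. }
split; apply Series_correct.
- apply (ex_series_ext (fun m => a ^ m * cos (b ^ m * PI * x))).
  + intros m; now rewrite Hterm.
  + apply ex_series_geom_bounded; [exact Ha|].
    intros m; apply Rabs_le, COS_bound.
- apply (ex_series_ext (fun m => a ^ m * sin (b ^ m * PI * x))).
  + intros m; now rewrite Hterm.
  + apply ex_series_geom_bounded; [exact Ha|].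
    intros m; apply Rabs_le, SIN_bound.
Qed.

(* Main.v *)
Require Import Defs.
From Stdlib Require Import Reals ZArith.
From Stdlib Require Import Lra Lia.
From Coquelicot Require Import Coquelicot.
Open Scope R_scope.

(** The [m]-th terms of the two sums are [a ^ m * z ^ n] and [a ^ m * w ^ n],
    where, with [k = b ^ m * PI] and [t = x / n],
    [z = cos t + i * k * sin t] and [w = exp (i * k * t)].
    Both numbers are [1 + i * k * t] up to an error of order [(k * t) ^ 2], so
    [z - w] is of that order ([Cmod_base_diff_le]), while [Cmod z] is at most
    [exp ((k * t) ^ 2)] ([Cmod_base_le]).  Taking [n]-th powers multiplies the
    difference by at most [n * exp (n * (k * t) ^ 2)] ([Cmod_pow_diff_le]), which
    leaves an error of order [T * exp T] with [T = (k * x) ^ 2 / n]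
    ([superosc_term_le]).

    For [m <= N] and [Rabs x <= M], [T] is at most
    [(PI * M) ^ 2 * (b ^ 2) ^ N / n].  Since [1 <= a * b], we have
    [b ^ 2 <= a * b ^ 3], so the growth condition makes this bound tend to [0]
    uniformly in [m] and [x].  The weights [a ^ m] have the finite sum
    [1 / (1 - a)], so the partial sums up to [N] are uniformly close, and the
    remaining tail of the Weierstrass series is at most
    [a ^ (N + 1) / (1 - a)]. *)

(** * Geometrically dominated complex series *)

Lemma sum_n_Cminus (u v : nat -> C) (N : nat) :
  sum_n (fun m => u m - v m)%C N = (sum_n u N - sum_n v N)%C.
Proof.
induction N as [|N IH].
- now rewrite !sum_O.
- rewrite !sum_Sn, IH.
  change ((sum_n u N - sum_n v N) + (u (S N) - v (S N))
          = (sum_n u N + u (S N)) - (sum_n v N + v (S N)))%C.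
  ring.
Qed.

Lemma Cmod_sum_n_geom_le (a E : R) (u : nat -> C) (N : nat) :
  0 < a < 1 -> 0 <= E ->
  (forall m, (m <= N)%nat -> Cmod (u m) <= E * a ^ m) ->
  Cmod (sum_n u N) <= E / (1 - a).
Proof.
intros Ha HE Hu.
(* The closed form of the geometric sum is what the induction carries. *)
enough (H : Cmod (sum_n u N) <= E * (1 - a ^ S N) / (1 - a)).
{ apply (Rle_trans _ _ _ H).
  apply Rmult_le_compat_r; [left; apply Rinv_0_lt_compat; lra |].
  assert (0 < a ^ S N) by (apply pow_lt; lra). nra. }
induction N as [|N IH].
- rewrite sum_O. apply (Rle_trans _ _ _ (Hu 0%nat (le_n _))).
  right; simpl; field; lra.
- rewrite sum_Sn. apply (Rle_trans _ _ _ (Cmod_triangle _ _)).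
  apply Rle_trans with (E * (1 - a ^ S N) / (1 - a) + E * a ^ S N).
  + apply Rplus_le_compat; [apply IH; intros; apply Hu; lia | now apply Hu].
  + right; simpl; field; lra.
Qed.

Lemma Cmod_series_geom_le (a E : R) (u : nat -> C) (l : C) :
  0 < a < 1 -> 0 <= E ->
  (forall m, Cmod (u m) <= E * a ^ m) ->
  is_series u l -> Cmod l <= E / (1 - a).
Proof.
intros Ha HE Hu Hl. apply le_epsilon; intros eps Heps.
apply is_series_C_components in Hl; destruct Hl as [HRe HIm].
assert (He : 0 < eps / 2) by lra.
destruct (filter_and _ _
  (proj1 (filterlim_locally _ _) HRe (mkposreal _ He))
  (proj1 (filterlim_locally _ _) HIm (mkposreal _ He))) as [K HK].
destruct (HK K (le_n _)) as [H1 H2].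
change (Rabs (sum_n (fun m => Re (u m)) K - Re l) < eps / 2) in H1.
change (Rabs (sum_n (fun m => Im (u m)) K - Im l) < eps / 2) in H2.
assert (HS := Cmod_sum_n_geom_le a E u K Ha HE (fun m _ => Hu m)).
rewrite sum_n_C_components in HS.
set (p := sum_n (fun m => Re (u m)) K) in *.
set (q := sum_n (fun m => Im (u m)) K) in *.
replace l with (((p, q) + (RtoC (Re l - p) + Ci * RtoC (Im l - q)))%C).
2:{ destruct l as [x y]; unfold Cplus, Cmult, RtoC, Ci; simpl; f_equal; ring. }
apply (Rle_trans _ _ _ (Cmod_triangle _ _)).
apply Rplus_le_compat; [exact HS |].
apply (Rle_trans _ _ _ (Cmod_triangle _ _)).
rewrite Cmod_mult, Cmod_Ci, !Cmod_R.
rewrite <- Rabs_Ropp in H1. rewrite <- Rabs_Ropp in H2.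
replace (- (p - Re l)) with (Re l - p) in H1 by ring.
replace (- (q - Im l)) with (Im l - q) in H2 by ring.
lra.
Qed.

(** * Powers of nearby complex numbers *)

(** Telescoping [z ^ n - w ^ n] gives [n] terms, each a product of [z - w] with
    [n - 1] factors of modulus at most [L]; as [1 <= L], the power may be
    rounded up to [L ^ n]. *)
Lemma Cmod_pow_diff_le (z w : C) (L : R) (n : nat) :
  1 <= L -> Cmod z <= L -> Cmod w <= L ->
  Cmod (z ^ n - w ^ n)%C <= INR n * Cmod (z - w)%C * L ^ n.
Proof.
intros HL Hz Hw.
assert (Hd := Cmod_ge_0 (z - w)%C).
induction n as [|n IH].
- simpl. unfold Cminus at 1. rewrite Cplus_opp_r, Cmod_0. lra.
- replace (z ^ S n - w ^ S n)%C with (z * (z ^ n - w ^ n) + (z - w) * w ^ n)%C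
    by (rewrite !Cpow_S; ring).
  apply (Rle_trans _ _ _ (Cmod_triangle _ _)).
  rewrite !Cmod_mult, Cmod_pow, S_INR. simpl.
  assert (Hp : 0 <= L ^ n) by (apply pow_le; lra).
  assert (Hwn : Cmod w ^ n <= L ^ n)
    by (apply pow_incr; split; [apply Cmod_ge_0 | exact Hw]).
  assert (Hn := pos_INR n).
  assert (H1 : Cmod z * Cmod (z ^ n - w ^ n)%C
            <= L * (INR n * Cmod (z - w)%C * L ^ n))
    by (apply Rmult_le_compat; auto using Cmod_ge_0).
  assert (H2 : Cmod (z - w)%C * Cmod w ^ n <= Cmod (z - w)%C * (L * L ^ n)).
  { apply Rmult_le_compat_l; [exact Hd |]. nra. }
  lra.
Qed.

Lemma de_Moivre (u : R) (n : nat) :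
  ((cos u, sin u) ^ n)%C = (cos (INR n * u), sin (INR n * u)).
Proof.
induction n as [|n IH].
- simpl. now rewrite Rmult_0_l, cos_0, sin_0.
- rewrite S_INR, Rmult_plus_distr_r, Rmult_1_l, cos_plus, sin_plus.
  simpl. rewrite IH. unfold Cmult; simpl. f_equal; ring.
Qed.

Lemma Cmod_cos_sin (u : R) : Cmod (cos u, sin u) = 1.
Proof.
unfold Cmod; simpl.
replace (cos u * (cos u * 1) + sin u * (sin u * 1)) with 1
  by (generalize (sin2_cos2 u); unfold Rsqr; lra).
apply sqrt_1.
Qed.

(** * Second-order trigonometric bounds *)

Lemma Rabs_sin_le (u : R) : Rabs (sin u) <= Rabs u.
Proof.
destruct (MVT_gen sin 0 u cos) as [c [_ Hc]].
- intros c _. apply is_derive_Reals, derivable_pt_lim_sin.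
- intros c _. apply continuity_sin.
- rewrite sin_0, !Rminus_0_r in Hc. rewrite Hc, Rabs_mult.
  assert (Rabs (cos c) <= 1) by (apply Rabs_le, COS_bound).
  assert (Hu := Rabs_pos u). nra.
Qed.

Lemma sin_sqr_le (u : R) : sin u ^ 2 <= u ^ 2.
Proof. rewrite <- !Rsqr_pow2. apply Rsqr_le_abs_1, Rabs_sin_le. Qed.

Lemma one_minus_cos (u : R) : 1 - cos u = 2 * sin (u / 2) ^ 2.
Proof.
replace u with (2 * (u / 2)) at 1 by field.
rewrite cos_2a_sin. ring.
Qed.

Lemma one_minus_cos_le_sqr (u : R) : 1 - cos u <= u ^ 2 / 2.
Proof. rewrite one_minus_cos. assert (H := sin_sqr_le (u / 2)). lra. Qed.

(** By the mean value theorem [u - sin u = u * (1 - cos c)] with [c] between [0]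
    and [u]; the first-order bound [1 - cos c <= Rabs c] suffices. *)
Lemma Rabs_sin_minus_id_le (u : R) : Rabs (sin u - u) <= u ^ 2.
Proof.
destruct (MVT_gen (fun v => sin v - v) 0 u (fun v => cos v - 1)) as [c [Hc H]].
- intros c _. auto_derive; [trivial | ring].
- intros c _. apply continuity_pt_minus;
    [apply continuity_sin | apply continuity_pt_id].
- rewrite sin_0 in H. replace (sin u - u) with ((cos c - 1) * u) by lra.
  rewrite Rabs_mult, <- Rsqr_pow2, Rsqr_abs. unfold Rsqr.
  apply Rmult_le_compat_r; [apply Rabs_pos |].
  apply Rle_trans with (Rabs c).
  + rewrite Rabs_minus_sym, one_minus_cos.
    assert (Hs := Rabs_sin_le (c / 2)).
    assert (Hs1 : Rabs (sin (c / 2)) <= 1) by (apply Rabs_le, SIN_bound).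
    assert (Hs0 := Rabs_pos (sin (c / 2))).
    unfold Rdiv in Hs at 2. rewrite Rabs_mult, (Rabs_right (/ 2)) in Hs by lra.
    rewrite Rabs_mult, <- RPow_abs, (Rabs_right 2) by lra. nra.
  + revert Hc. unfold Rmin, Rmax, Rabs.
    destruct (Rle_dec 0 u), (Rcase_abs c), (Rcase_abs u); lra.
Qed.

(** * Comparison of a single term with the exponential *)

Lemma Cmod_base_le (k t : R) :
  Cmod (cos t, k * sin t) <= exp ((k * t) ^ 2).
Proof.
apply Rle_trans with (1 + (k * t) ^ 2); [| apply exp_ineq1_le].
assert (Hkt := pow2_ge_0 (k * t)).
unfold Cmod; simpl fst; simpl snd.
apply Rle_trans with (sqrt ((1 + (k * t) ^ 2) ^ 2)).
- apply sqrt_le_1_alt.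
  assert (Hc : cos t ^ 2 <= 1).
  { generalize (sin2_cos2 t) (pow2_ge_0 (sin t)). rewrite !Rsqr_pow2. lra. }
  assert (Hs := sin_sqr_le t). assert (Hk := pow2_ge_0 k).
  assert ((k * sin t) ^ 2 <= (k * t) ^ 2) by (rewrite !Rpow_mult_distr; nra).
  nra.
- rewrite sqrt_pow2; lra.
Qed.

(** The real parts are both [1] and the imaginary parts both [k * t] up to second
    order.  The condition [1 <= k] lets [t ^ 2] and [k * t ^ 2] be absorbed in
    [(k * t) ^ 2]. *)
Lemma Cmod_base_diff_le (k t : R) :
  1 <= k ->
  Cmod ((cos t, (k * sin t)%R) - (cos (k * t), sin (k * t)))%C <= 3 * (k * t) ^ 2.
Proof.
intros Hk.
replace ((cos t, (k * sin t)%R) - (cos (k * t), sin (k * t)))%C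
  with (RtoC (cos t - cos (k * t)) + Ci * RtoC (k * sin t - sin (k * t)))%C
  by (unfold Cminus, Cplus, Copp, Cmult, RtoC, Ci; simpl; f_equal; ring).
apply (Rle_trans _ _ _ (Cmod_triangle _ _)).
rewrite Cmod_mult, Cmod_Ci, !Cmod_R.
assert (Ht := pow2_ge_0 t).
assert (Hkt : t ^ 2 <= k * t ^ 2 <= (k * t) ^ 2)
  by (rewrite Rpow_mult_distr; nra).
assert (Hre : Rabs (cos t - cos (k * t)) <= (k * t) ^ 2 / 2).
{ generalize (one_minus_cos_le_sqr t) (one_minus_cos_le_sqr (k * t))
    (COS_bound t) (COS_bound (k * t)).
  intros; apply Rabs_le; lra. }
assert (Him : Rabs (k * sin t - sin (k * t)) <= 2 * (k * t) ^ 2).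
{ replace (k * sin t - sin (k * t))
    with (k * (sin t - t) - (sin (k * t) - k * t)) by ring.
  apply (Rle_trans _ _ _ (Rabs_triang _ _)).
  rewrite Rabs_Ropp, Rabs_mult, (Rabs_right k) by lra.
  generalize (Rabs_sin_minus_id_le t) (Rabs_sin_minus_id_le (k * t)).
  intros; nra. }
assert (H0 := pow2_ge_0 (k * t)). lra.
Qed.

Lemma exp_INR_mult (y : R) (n : nat) : exp y ^ n = exp (INR n * y).
Proof.
induction n as [|n IH].
- now rewrite Rmult_0_l, exp_0.
- rewrite S_INR, Rmult_plus_distr_r, Rmult_1_l, exp_plus, <- IH. simpl; ring.
Qed.

Lemma Cexp_Ci (u : R) : Cexp (Ci * RtoC u)%C = (cos u, sin u).
Proof.
unfold Cexp, Cmult, RtoC, Ci, Re, Im; simpl.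
replace (0 * u - 1 * 0) with 0 by ring.
replace (0 * 0 + 1 * u) with u by ring.
rewrite exp_0; f_equal; ring.
Qed.

Lemma superosc_term_le (k x : R) (n : nat) :
  1 <= k -> (0 < n)%nat ->
  Cmod ((RtoC (cos (x / INR n)) + Ci * RtoC k * RtoC (sin (x / INR n))) ^ n
        - Cexp (Ci * RtoC (k * x)))%C
  <= 3 * ((k * x) ^ 2 / INR n) * exp ((k * x) ^ 2 / INR n).
Proof.
intros Hk Hn. assert (HN := lt_0_INR n Hn).
set (t := x / INR n).
replace (RtoC (cos t) + Ci * RtoC k * RtoC (sin t))%C
  with (cos t, k * sin t)
  by (unfold Cplus, Cmult, RtoC, Ci; simpl; f_equal; ring).
replace (Cexp (Ci * RtoC (k * x))) with ((cos (k * t), sin (k * t)) ^ n)%C.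
2:{ rewrite de_Moivre, Cexp_Ci.
    now replace (INR n * (k * t)) with (k * x) by (unfold t; field; lra). }
assert (Hsq : INR n * (k * t) ^ 2 = (k * x) ^ 2 / INR n)
  by (unfold t; field; lra).
set (L := exp ((k * t) ^ 2)).
assert (HL : 1 <= L).
{ unfold L. generalize (exp_ineq1_le ((k * t) ^ 2)) (pow2_ge_0 (k * t)). lra. }
assert (HLn : L ^ n = exp ((k * x) ^ 2 / INR n)).
{ rewrite <- Hsq. apply exp_INR_mult. }
apply Rle_trans with
  (INR n * Cmod ((cos t, (k * sin t)%R) - (cos (k * t), sin (k * t)))%C * L ^ n).
- apply Cmod_pow_diff_le; [exact HL | apply Cmod_base_le |].
  now rewrite Cmod_cos_sin.
- rewrite HLn, <- Hsq. apply Rmult_le_compat_r; [left; apply exp_pos |].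
  rewrite <- Rmult_assoc, (Rmult_comm 3), Rmult_assoc.
  apply Rmult_le_compat_l; [lra | now apply Cmod_base_diff_le].
Qed.

(** * Uniform error bounds *)

Lemma weierstrass_tail_le (a b x : R) (N : nat) :
  0 < a < 1 ->
  Cmod (sum_n (weierstrass_term a b x) N - weierstrass a b x)%C
  <= a ^ S N / (1 - a).
Proof.
intros Ha.
assert (Hs := weierstrass_is_series a b x Ha).
rewrite <- Cmod_opp.
apply (Cmod_series_geom_le a _ (fun m => weierstrass_term a b x (S N + m))).
- exact Ha.
- left; apply pow_lt; lra.
- intros m. unfold weierstrass_term.
  rewrite Cexp_Ci, Cmod_mult, Cmod_cos_sin, Cmod_R, Rmult_1_r, pow_add.
  rewrite Rabs_right; [lra |].
  apply Rle_ge, Rmult_le_pos; apply pow_le; lra.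
- apply is_series_incr_n; [lia |].
  replace (plus _ _) with (weierstrass a b x); [exact Hs |].
  simpl pred.
  change (weierstrass a b x
          = - (sum_n (weierstrass_term a b x) N - weierstrass a b x)
            + sum_n (weierstrass_term a b x) N)%C.
  ring.
Qed.

(** For [m <= N] the frequency [b ^ m * PI] is at most [b ^ N * PI], so one error
    bound serves all the terms of the partial sum. *)
Lemma superosc_weierstrass_le (M a b x : R) (N n : nat) :
  0 < a < 1 -> 1 <= b -> (0 < n)%nat -> Rabs x <= M ->
  let T := (PI * M) ^ 2 * ((b ^ 2) ^ N / INR n) in
  Cmod (superosc a b N n x - weierstrass a b x)%C
  <= 3 * T * exp T / (1 - a) + a ^ S N / (1 - a).
Proof.
intros Ha Hb Hn Hx T. assert (HN := lt_0_INR n Hn).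
assert (HPI : 1 <= PI) by (generalize PI2_1; lra).
assert (HT : 0 <= T).
{ apply Rmult_le_pos; [apply pow2_ge_0 |].
  apply Rle_mult_inv_pos; [apply pow_le, pow2_ge_0 | exact HN]. }
replace (superosc a b N n x - weierstrass a b x)%C
  with ((superosc a b N n x - sum_n (weierstrass_term a b x) N)
        + (sum_n (weierstrass_term a b x) N - weierstrass a b x))%C by ring.
apply (Rle_trans _ _ _ (Cmod_triangle _ _)).
apply Rplus_le_compat; [| now apply weierstrass_tail_le].
unfold superosc. rewrite <- sum_n_Cminus.
apply Cmod_sum_n_geom_le; [exact Ha | |].
{ generalize (exp_pos T); intros; nra. }
intros m Hm. unfold weierstrass_term.
match goal with |- Cmod (RtoC (a ^ m) * ?z - RtoC (a ^ m) * ?w)%C <= _ =>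
  replace (RtoC (a ^ m) * z - RtoC (a ^ m) * w)%C
    with (RtoC (a ^ m) * (z - w))%C by ring end.
assert (Ham : 0 < a ^ m) by (apply pow_lt; lra).
rewrite Cmod_mult, Cmod_R, Rabs_right, Rmult_comm by lra.
apply Rmult_le_compat_r; [lra |].
assert (Hbm : 1 <= b ^ m <= b ^ N)
  by (split; [now apply pow_R1_Rle | now apply Rle_pow]).
apply Rle_trans with (1 := superosc_term_le (b ^ m * PI) x n ltac:(nra) Hn).
set (t := (b ^ m * PI * x) ^ 2 / INR n).
assert (Ht : 0 <= t <= T).
{ unfold t, T. split.
  - apply Rle_mult_inv_pos; [apply pow2_ge_0 | exact HN].
  - unfold Rdiv. rewrite <- Rmult_assoc.
    apply Rmult_le_compat_r; [left; now apply Rinv_0_lt_compat |].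
    rewrite <- pow_mult, Nat.mul_comm, pow_mult, <- Rpow_mult_distr.
    rewrite <- !Rsqr_pow2. apply Rsqr_le_abs_1.
    rewrite !Rabs_mult, (Rabs_right PI), (Rabs_right (b ^ m)),
      (Rabs_right (b ^ N)), (Rabs_right M)
      by (generalize (Rabs_pos x); lra).
    apply Rle_trans with (b ^ N * PI * M); [| lra].
    apply Rmult_le_compat; [nra | apply Rabs_pos | nra | exact Hx]. }
apply Rmult_le_compat; [lra | left; apply exp_pos | lra |].
destruct (Rle_lt_or_eq_dec _ _ (proj2 Ht)) as [Hlt | ->];
  [left; now apply exp_increasing | lra].
Qed.

Lemma sup_dist_bounded (M B : R) (f g : R -> C) :
  0 < M ->
  (forall x, Rabs x <= M -> Cmod (f x - g x)%C <= B) ->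
  is_finite (sup_dist M f g) /\ 0 <= real (sup_dist M f g) <= B.
Proof.
intros HM HB. unfold sup_dist.
destruct (Lub_Rbar_correct (fun y : R =>
  exists x : R, Rabs x <= M /\ y = Cmod (f x - g x)%C)) as [Hub Hleast].
set (s := Lub_Rbar _) in *.
assert (Hle : Rbar_le s B).
{ apply Hleast. intros y [x [Hx ->]]. exact (HB x Hx). }
assert (Hge : Rbar_le (Cmod (f 0 - g 0)%C) s).
{ apply Hub. exists 0. rewrite Rabs_R0. split; [lra | reflexivity]. }
assert (H0 := Cmod_ge_0 (f 0 - g 0)%C).
destruct s as [s| |]; simpl in *; try easy.
split; [reflexivity | lra].
Qed.

Theorem theorem4p1
    (M a : R) (b : Z) (n : nat -> nat)
    (hM : 0 < M)
    (ha : 0 < a < 1)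
    (hb : (1 < b)%Z)
    (hbodd : Z.Odd b)
    (hab : 1 + 3 / 2 * PI < a * IZR b)
    (hn : forall N : nat, (0 < n N)%nat)
    (hgrowth : is_lim_seq (fun N : nat => (a * IZR b ^ 3) ^ N / INR (n N)) 0) :
  (forall N : nat,
     is_finite (sup_dist M (superosc a (IZR b) N (n N)) (weierstrass a (IZR b)))) /\
  is_lim_seq
    (fun N : nat =>
       real (sup_dist M (superosc a (IZR b) N (n N)) (weierstrass a (IZR b)))) 0.
Proof.
assert (Hb : 1 <= IZR b) by (apply IZR_le; lia).
assert (Hab : 1 <= a * IZR b) by (generalize PI_RGT_0; lra).
set (T := fun N => (PI * M) ^ 2 * ((IZR b ^ 2) ^ N / INR (n N))).
assert (HT : is_lim_seq T 0).
{ replace 0 with ((PI * M) ^ 2 * 0) by ring.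
  apply (is_lim_seq_scal_l _ _ (Finite 0)).
  apply is_lim_seq_le_le with (3 := hgrowth) (u := fun _ => 0).
  - intros N. assert (HN := lt_0_INR _ (hn N)). split.
    + apply Rle_mult_inv_pos; [apply pow_le, pow2_ge_0 | exact HN].
    + apply Rmult_le_compat_r; [left; now apply Rinv_0_lt_compat |].
      apply pow_incr. split; [apply pow2_ge_0 |].
      assert (H := pow2_ge_0 (IZR b)).
      replace (a * IZR b ^ 3) with (a * IZR b * IZR b ^ 2) by ring. nra.
  - apply is_lim_seq_const. }
assert (Hsup : forall N,
  is_finite (sup_dist M (superosc a (IZR b) N (n N)) (weierstrass a (IZR b))) /\
  0 <= real (sup_dist M (superosc a (IZR b) N (n N)) (weierstrass a (IZR b)))
    <= 3 * T N * exp (T N) / (1 - a) + a ^ S N / (1 - a)).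
{ intros N. apply sup_dist_bounded; [exact hM |].
  intros x Hx. now apply superosc_weierstrass_le. }
split; [intros N; apply Hsup |].
apply is_lim_seq_le_le with (u := fun _ => 0)
  (w := fun N => 3 * T N * exp (T N) / (1 - a) + a ^ S N / (1 - a)).
- intros N; apply Hsup.
- apply is_lim_seq_const.
- replace (Finite 0) with (Finite (3 * 0 * exp 0 / (1 - a) + 0 / (1 - a)))
    by (f_equal; field; lra).
  apply is_lim_seq_plus'; apply is_lim_seq_div'; try lra;
    try apply is_lim_seq_const.
  + apply is_lim_seq_mult'.
    * apply is_lim_seq_mult'; [apply is_lim_seq_const | exact HT].
    * apply is_lim_seq_continuous; [| exact HT].
      apply derivable_continuous_pt, derivable_pt_exp.
  + apply -> is_lim_seq_incr_1. apply is_lim_seq_geom.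
    rewrite Rabs_right; lra.
Qed.
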